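(* Let $m \geq 1$ be an integer and let $q \in \mathbb{C}$ be any even root of unity (that is, a primitive $N$th root of unity with $N$ even). Then $$\sum_{n_m \geq \dots \geq n_1 \geq 0} (-q)_{n_m}(q)_{n_1}q^{n_m+1}\prod_{i=1}^{m-1} q^{n_i^2+n_i} \begin{bmatrix} n_{i+1} \\ n_i \end{bmatrix} = -\sum_{n_m \geq \dots \geq n_1 \geq 0} (-q)_{n_m}(-1)^{n_m+ n_1}q^{- \binom{n_1+1}{2}}\prod_{i=1}^{m-1} q^{n_i^2+n_i} \begin{bmatrix} n_{i+1} \\ n_i \end{bmatrix},$$ where both sums run over all $m$-tuples of integers $(n_1,\dots,n_m)$ with $n_m \geq \cdots \geq n_1 \geq 0$.
   Context: For a non-negative integer $n$, $(a)_n = (a;q)_n = \prod_{k=0}^{n-1}(1-aq^k)$, so $(q)_n = \prod_{k=1}^{n}(1-q^k)$ and $(-q)_n=\prod_{k=1}^n(1+q^k)$. The $q$-binomial coefficient (Gaussian polynomial) is $\begin{bmatrix} n \\ k \end{bmatrix} = \begin{bmatrix} n \\ k \end{bmatrix}_q = \frac{(q)_n}{(q)_{n-k}(q)_k}$ if $0 \leq k \leq n$ and $0$ otherwise; it is a polynomial in $q$, and at a root of unity it means the value of this polynomial. Empty products equal $1$. If $q$ is a primitive $N$th root of unity with $N$ even then $(-q)_{n_m}=0$ for $n_m \geq N/2$, so both sums have only finitely many nonzero terms. *)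

(* Defs.v *)
From mathcomp Require Import all_boot all_order all_algebra.
From mathcomp Require Import finmap.
From mathcomp Require Import classical_sets cardinality fsbigop.
From mathcomp Require Import ring.

Set Implicit Arguments.
Unset Strict Implicit.
Unset Printing Implicit Defensive.

Import Order.TTheory GRing.Theory Num.Theory.
Local Open Scope classical_set_scope.
Local Open Scope ring_scope.

Definition qpoch (R : comNzRingType) (a q : R) (n : nat) : R :=
  \prod_(0 <= k < n) (1 - a * q ^+ k).

(* [%/] is Euclidean division of polynomials; it is exact here, see
   [qbinom_polyE]. *)
Definition qbinom_poly (F : fieldType) (n k : nat) : {poly F} :=
  if (k <= n)%N
  then qpoch 'X 'X n %/ (qpoch 'X 'X (n - k) * qpoch 'X 'X k)
  else 0.

Definition qbinom (F : fieldType) (q : F) (n k : nat) : F :=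
  (qbinom_poly F n k).[q].

(* Parts are numbered from 1: [part n i] is n_i for 1 <= i <= m. *)
Definition part (m : nat) (n : m.-tuple nat) (i : nat) : nat :=
  nth 0%N n i.-1.

Definition chains m : set (m.-tuple nat) :=
  [set n : m.-tuple nat | sorted leq n].
Arguments chains m : clear implicits.

Lemma qpoch_recr (R : comNzRingType) (a q : R) n :
  qpoch a q n.+1 = qpoch a q n * (1 - a * q ^+ n).
Proof. by rewrite /qpoch big_nat_recr. Qed.

Lemma qpochX_neq0 (F : fieldType) n : qpoch 'X 'X n != 0 :> {poly F}.
Proof.
rewrite /qpoch big_mkord; apply/prodf_neq0 => k _.
rewrite -exprS; apply/eqP => /(congr1 (fun p : {poly F} => p.[0])).
by rewrite !hornerE /= exprS mul0r subr0 => /eqP; rewrite oner_eq0.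
Qed.

Lemma dvd_qpochX (F : fieldType) n m :
  (qpoch 'X 'X n * qpoch 'X 'X m : {poly F}) %| qpoch 'X 'X (n + m).
Proof.
have [s] := ubnP (n + m); elim: s n m => // s IHs [|n] [|m] lt_s;
  rewrite ?addn0 ?add0n /qpoch ?big_nil ?mulr1 ?mul1r ?big_nil ?mulr1 //.
rewrite -!/(qpoch _ _ _) addSn [qpoch _ _ (_ + _).+1]qpoch_recr.
have -> : 1 - 'X * 'X ^+ (n + m.+1) =
    (1 - 'X * 'X ^+ n) + 'X ^+ n.+1 * (1 - 'X * 'X ^+ m) :> {poly F}.
  by rewrite addnS !exprS exprD; ring.
rewrite mulrDr dvdp_add //.
  rewrite [qpoch _ _ n.+1]qpoch_recr mulrAC dvdp_mul //.
  by apply: IHs; rewrite -ltnS -addSn.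
rewrite [qpoch _ _ m.+1]qpoch_recr mulrA mulrCA dvdp_mull // dvdp_mul //.
by rewrite addnS -addSn; apply: IHs; rewrite -ltnS -addnS.
Qed.

Lemma qbinom_polyE (F : fieldType) n k : (k <= n)%N ->
  qbinom_poly F n k * (qpoch 'X 'X (n - k) * qpoch 'X 'X k) = qpoch 'X 'X n.
Proof.
move=> le_kn; rewrite /qbinom_poly le_kn divpK //.
by rewrite -{2}(subnK le_kn) dvd_qpochX.
Qed.

Lemma qpochN_eq0 (F : fieldType) (N : nat) (q : F) n :
  ~~ odd N -> N.-primitive_root q -> (N./2 <= n)%N -> qpoch (- q) q n = 0.
Proof.
move=> N_even q_prim le_n.
have N_gt0 := prim_order_gt0 q_prim.
have h_gt0 : (0 < N./2)%N.
  by rewrite half_gt0; case: N N_gt0 N_even {le_n q_prim} => [|[|]].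
have qhN : q ^+ N./2 = -1.
  have : (q ^+ N./2) ^+ 2 == 1.
    by rewrite -exprM muln2 even_halfK // prim_expr_order.
  rewrite sqrf_eq1 => /orP[|/eqP//].
  rewrite -(prim_order_dvd q_prim) => /(dvdn_leq h_gt0).
  rewrite leqNgt -{2}(even_halfK N_even) -addnn -[X in (X < _)%N]addn0.
  by rewrite ltn_add2l h_gt0.
rewrite /qpoch big_mkord.
have lt_n : (N./2.-1 < n)%N by rewrite prednK.
apply/eqP/prodf_eq0; exists (Ordinal lt_n) => //=.
by rewrite mulNr opprK -exprS prednK // qhN subrr.
Qed.

(* Hence the finitely supported sums over [chains m] of terms that carry the
   factor (-q)_{n_m} never take their default value for infinite supports. *)
Lemma finite_chains_support (F : fieldType) (N : nat) (q : F) (m : nat)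
    (f : m.-tuple nat -> F) :
  ~~ odd N -> N.-primitive_root q ->
  (forall n, qpoch (- q) q (part n m) = 0 -> f n = 0) ->
  finite_set (chains m `&` f @^-1` [set~ 0]).
Proof.
move=> N_even q_prim f0.
apply: (@sub_finite_set _ _
  [set map_tuple (@nat_of_ord N./2) t | t in [set: m.-tuple 'I_N./2]]);
  last by apply: finite_image; exact: finite_finset.
move=> n [/= n_sorted fn_neq0].
have n_lt i : (i < m)%N -> (nth 0%N n i < N./2)%N.
  move=> lt_im; rewrite ltnNge; apply/negP => le_h.
  apply: fn_neq0; apply: f0; apply: (qpochN_eq0 N_even q_prim).
  apply: leq_trans le_h _; rewrite /part.
  have m_gt0 : (0 < m)%N by apply: leq_ltn_trans lt_im.
  apply: (sorted_leq_nth leq_trans leqnn) => //; rewrite ?inE ?size_tuple //.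
    by rewrite prednK.
  by rewrite -ltnS prednK.
exists [tuple Ordinal (n_lt i (ltn_ord i)) | i < m] => //.
by apply: eq_from_tnth => i; rewrite tnth_map tnth_mktuple /= (tnth_nth 0%N).
Qed.

(* Main.v *)
Require Import Defs.
From mathcomp Require Import all_boot all_order all_algebra.
From mathcomp Require Import classical_sets fsbigop reals complex.
From mathcomp Require Import ring zify.

Set Implicit Arguments.
Unset Strict Implicit.
Unset Printing Implicit Defensive.

Import GRing.Theory.
Local Open Scope ring_scope.

(** Write [n,k] for the Gaussian binomial at q and let T be the lower triangular
    operator (T b)(n) = sum_k q^(k^2+k) [n,k] b(k).  Summing a chain from the
    bottom up, a sum over n_m >= ... >= n_1 of a(n_m) b(n_1) times the product
    of the q^(n_i^2+n_i) [n_{i+1},n_i] is the pairing sum_n a(n) (T^(m-1) b)(n)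
    ([sum_chains]); when a carries the factor (-q)_n it is supported on n < N/2.

    With g(k) = (-1)^k q^(-binom(k+1,2)), the left side of the theorem is
    L(T^(m-1) (q)_.) and the right side is -M(T^(m-1) g), for the functionals
    L(b) = sum_n (-q)_n q^(n+1) b(n) and M(b) = sum_n (-q)_n (-1)^n b(n).
    Two facts tie them together:
    - T g = (q)_., because q^(k^2+k) turns q^(-binom(k+1,2)) into
      q^binom(k+1,2), and the sum is then Cauchy's q-binomial theorem at x = q
      ([lower_apply_chain_kernel_dual]);
    - L o T = - M as soon as (-q)_h = 0, where h = N/2 bounds the sums
      ([sum_lower_apply_chain_kernel]).  This is the evaluation of each column
      sum of the kernel, [qpochN_column_sum], a terminating q-Chu-Vandermonde
      sum in which -q plays the role of q^(1-h).
    Hence L(T^(m-1) (q)_.) = L(T^m g) = L(T (T^(m-1) g)) = - M(T^(m-1) g): the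
    extra factor of T is created at the bottom of the chain and absorbed at the
    top. *)

(** * Gaussian polynomials *)

Section GaussianPolynomials.
Variable F : fieldType.
Implicit Types (q x : F) (n k : nat).

(** The absorption rules are obtained between polynomials, where the
    q-factorials can be cancelled, and only then evaluated: at a root of unity
    these factors may vanish. *)
Lemma qbinom_poly_mul_succ n k :
  qbinom_poly F n k.+1 * (1 - 'X^(k.+1)) = (1 - 'X^(n - k)) * qbinom_poly F n k.
Proof.
have [lt_kn|le_nk] := ltnP k n; last first.
  have -> : (n - k)%N = 0%N by apply/eqP; rewrite subn_eq0.
  by rewrite /qbinom_poly ltnNge le_nk mul0r expr0 subrr mul0r.
apply: (mulIf (x := qpoch 'X 'X (n - k.+1) * qpoch 'X 'X k)).
  by rewrite mulf_neq0 ?qpochX_neq0.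
transitivity (qpoch 'X 'X n : {poly F}).
  by rewrite -(qbinom_polyE F lt_kn) qpoch_recr -exprS; ring.
rewrite -(qbinom_polyE F (ltnW lt_kn)) -[in LHS](subnSK lt_kn) qpoch_recr.
by rewrite -exprS subnSK //; ring.
Qed.

Lemma qbinom_poly_succ_mul_succ n k : (k <= n)%N ->
  qbinom_poly F n.+1 k.+1 * (1 - 'X^(k.+1)) = (1 - 'X^(n.+1)) * qbinom_poly F n k.
Proof.
move=> le_kn; apply: (mulIf (x := qpoch 'X 'X (n - k) * qpoch 'X 'X k)).
  by rewrite mulf_neq0 ?qpochX_neq0.
rewrite -[RHS]mulrA (qbinom_polyE F le_kn).
have := qbinom_polyE F (le_kn : (k < n.+1)%N).
by rewrite subSS !qpoch_recr -!exprS => E; rewrite [RHS]mulrC -E; ring.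
Qed.

Lemma qbinom0 q n : qbinom q n 0 = 1.
Proof.
have := qbinom_polyE F (leq0n n); rewrite /qbinom subn0 /qpoch big_nil mulr1.
rewrite -/(qpoch _ _ _) -[RHS]mul1r => /(mulIf (qpochX_neq0 F n)) ->.
by rewrite hornerC.
Qed.

Lemma qbinom_gt q n k : (n < k)%N -> qbinom q n k = 0.
Proof. by move=> lt_nk; rewrite /qbinom /qbinom_poly leqNgt lt_nk horner0. Qed.

Lemma qbinom_mul_succ q n k :
  qbinom q n k.+1 * (1 - q ^+ k.+1) = (1 - q ^+ (n - k)) * qbinom q n k.
Proof.
have /(congr1 (horner^~ q)) := qbinom_poly_mul_succ n k.
by rewrite !hornerE.
Qed.

Lemma qbinom_pascal q n k :
  qbinom q n.+1 k.+1 = qbinom q n k.+1 + q ^+ (n - k) * qbinom q n k.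
Proof.
have [lt_nk|le_kn] := ltnP n k.
  by rewrite !qbinom_gt ?mulr0 ?addr0 // ltnW.
suff /(congr1 (horner^~ q)) : qbinom_poly F n.+1 k.+1 =
    qbinom_poly F n k.+1 + 'X^(n - k) * qbinom_poly F n k by rewrite !hornerE.
have nz : 1 - 'X^(k.+1) != 0 :> {poly F}.
  apply/eqP => /(congr1 (horner^~ 0)).
  by rewrite !hornerE exprS mul0r subr0 => /eqP; rewrite oner_eq0.
apply: (mulIf nz); rewrite mulrDl (qbinom_poly_mul_succ n k).
rewrite qbinom_poly_succ_mul_succ //.
have -> : 'X^(n.+1) = 'X^(n - k) * 'X^(k.+1) :> {poly F}.
  by rewrite -exprD addnS subnK.
by ring.
Qed.

(** Cauchy's q-binomial theorem.  By the Pascal rule, passing from n to n + 1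
    adds to the sum a copy of itself, shifted by one in k and multiplied by
    - x q^n. *)
Lemma qbinom_theorem q x n :
  qpoch x q n =
  \sum_(0 <= k < n.+1) (-1) ^+ k * q ^+ 'C(k, 2) * x ^+ k * qbinom q n k.
Proof.
elim: n => [|n IHn].
  by rewrite big_nat1 qbinom0 /qpoch big_nil; ring.
rewrite qpoch_recr mulrBr mulr1 big_nat_recl // qbinom0.
under eq_bigr => k _ do rewrite qbinom_pascal mulrDr.
rewrite big_split /= addrA; congr (_ + _).
  rewrite IHn [in LHS]big_nat_recl // qbinom0; congr (_ + _).
  by rewrite [in RHS]big_nat_recr //= qbinom_gt // mulr0 addr0.
rewrite IHn mulr_suml -sumrN !big_mkord; apply: eq_bigr => k _.
have -> : q ^+ n = q ^+ k * q ^+ (n - k) by rewrite -exprD subnKC // -ltnS.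
by rewrite binS bin1 exprD !exprS; ring.
Qed.

End GaussianPolynomials.

(** * Chain sums as iterated triangular operators *)

Section ChainSums.
Variable R : comNzRingType.
Variable K : nat -> nat -> R.
Hypothesis K_lower : forall n k, (n < k)%N -> K n k = 0.
Implicit Types a b : nat -> R.

Definition lower_apply b n : R := \sum_(0 <= k < n.+1) K n k * b k.

Lemma lower_apply_widen h b n : (n < h)%N ->
  lower_apply b n = \sum_(k < h) K n k * b k.
Proof.
move=> lt_nh; rewrite /lower_apply -(big_mkord xpredT (fun k => K n k * b k)).
rewrite [RHS](big_cat_nat _ (n := n.+1)) //= [X in _ = _ + X]big_nat_cond.
rewrite [X in _ = _ + X]big1 ?addr0 // => k /andP[/andP[lt_nk _] _].
by rewrite K_lower ?mul0r.
Qed.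

Lemma sum_tuple_cons m h (f : seq 'I_h -> R) :
  \sum_(t : m.+1.-tuple 'I_h) f t =
  \sum_(t : m.-tuple 'I_h) \sum_(x < h) f (x :: t).
Proof.
rewrite exchange_big pair_bigA /=.
rewrite (reindex (fun p : 'I_h * m.-tuple 'I_h => [tuple of p.1 :: p.2])) //=.
exists (fun t => (thead t, [tuple of behead t])) => [[x t] _|t _] /=.
  by rewrite theadE; congr pair; apply: val_inj.
by rewrite -tuple_eta.
Qed.

(** Summing over the smallest part of the chain replaces [b] by
    [lower_apply b], which is why the induction is on chains read from the
    bottom and generalizes [b].  Tuples are not required to be sorted here: the
    kernel vanishes on descents. *)
Lemma sum_chain_tuple h m a b :
  \sum_(t : m.+1.-tuple 'I_h)
     (let s := map (@nat_of_ord h) t in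
      a (nth 0%N s m) * b (nth 0%N s 0) *
      \prod_(0 <= i < m) K (nth 0%N s i.+1) (nth 0%N s i)) =
  \sum_(n < h) a n * iter m lower_apply b n.
Proof.
elim: m b => [|m IHm] b.
  rewrite (sum_tuple_cons _ (fun t => let s := map (@nat_of_ord h) t in
    a (nth 0%N s 0) * b (nth 0%N s 0) *
    \prod_(0 <= i < 0) K (nth 0%N s i.+1) (nth 0%N s i))) /=.
  rewrite (big_pred1 [tuple]) => [|t]; last by rewrite [t]tuple0 /= eqxx.
  by apply: eq_bigr => x _; rewrite big_geq ?mulr1.
rewrite (sum_tuple_cons _ (fun t => let s := map (@nat_of_ord h) t in
    a (nth 0%N s m.+1) * b (nth 0%N s 0) *
    \prod_(0 <= i < m.+1) K (nth 0%N s i.+1) (nth 0%N s i))) /=.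
under [RHS]eq_bigr => n _ do rewrite -iterS iterSr.
rewrite -IHm; apply: eq_bigr => t _ /=.
have lt_h : (nth 0 (map (@nat_of_ord h) t) 0 < h)%N.
  by case/tupleP: t => x t /=.
rewrite (lower_apply_widen _ lt_h) mulr_sumr mulr_suml; apply: eq_bigr => x _.
by rewrite big_nat_recl //=; ring.
Qed.

(** The sum over all chains is a sum over the box [0, h)^(m+1): unsorted tuples
    contribute nothing because the kernel is lower triangular, and a sorted
    tuple leaving the box has its last part at least [h], where [a] vanishes. *)
Lemma sum_chains h m a b : (forall n, (h <= n)%N -> a n = 0) ->
  \sum_(n \in chains m.+1)
     (a (part n m.+1) * b (part n 1) *
      \prod_(1 <= i < m.+1) K (part n i.+1) (part n i)) =
  \sum_(n < h) a n * iter m lower_apply b n.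
Proof.
move=> a0; rewrite -sum_chain_tuple.
pose f (n : m.+1.-tuple nat) := a (part n m.+1) * b (part n 1) *
  \prod_(1 <= i < m.+1) K (part n i.+1) (part n i).
have f_unsorted (n : m.+1.-tuple nat) : ~~ sorted leq n -> f n = 0.
  move=> n_unsorted; rewrite /f; set p := \prod_(_ <= _ < _) _.
  suff -> : p = 0 by rewrite mulr0.
  have : ~~ [forall i : 'I_m, (nth 0 n i <= nth 0 n i.+1)%N].
    apply: contra n_unsorted => /forallP le_n; apply/(sortedP 0%N) => i.
    by rewrite size_tuple ltnS => lt_im; apply: (le_n (Ordinal lt_im)).
  move=> /forallPn[i /=]; rewrite -ltnNge => lt_n.
  by rewrite /p big_add1 /= big_mkord (bigD1 i) //= /part /= K_lower ?mul0r.
rewrite (@fsbig_widen _ _ _ _ _ setT) //; last first.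
  by move=> n [_ /= /negP n_unsorted]; exact: f_unsorted.
have val_inj : injective (map_tuple (n := m.+1) (@nat_of_ord h)).
  move=> s t /(congr1 val) /= /(inj_map (@ord_inj h)); exact: val_inj.
rewrite (fsbigE (map (map_tuple (@nat_of_ord h)) (enum {: m.+1.-tuple 'I_h}))).
- under eq_bigl => n do rewrite in_setT.
  rewrite big_map big_enum; apply: eq_bigr => t _.
  by rewrite big_add1.
- by rewrite map_inj_uniq ?enum_uniq.
- by [].
move=> n _ n_out; have [n_sorted|] := boolP (sorted leq n); last exact: f_unsorted.
have [le_h|lt_h] := leqP h (nth 0%N n m); first by rewrite a0 // !mul0r.
have n_lt (i : 'I_m.+1) : (nth 0 n i < h)%N.
  apply: leq_ltn_trans lt_h.
  apply: (sorted_leq_nth leq_trans leqnn) => //; rewrite ?inE ?size_tuple //.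
  by rewrite -ltnS.
case/mapP: n_out; exists [tuple Ordinal (n_lt i) | i < m.+1].
  by rewrite mem_enum.
by apply: eq_from_tnth => i; rewrite tnth_map tnth_mktuple /= (tnth_nth 0%N).
Qed.

End ChainSums.

(** * The intertwining relation *)

Section Intertwining.
Variables (F : fieldType) (q : F) (h : nat).
Hypothesis q_half : qpoch (- q) q h = 0.

(** Since (-q)_n q^(n+1) is the difference (-q)_{n+1} - (-q)_n, summation by
    parts has no upper boundary term when (-q)_h = 0.  With A(k) the column sum,
    it gives, through the Pascal rule, a relation between A(k+1), A(k) and a sum
    with an additional weight q^(n+1); absorption expresses the latter by A(k)
    and A(k+1) again.  What results is
    q^(2(k+1)) A(k+1) = - (1 + q^(k+1)) A(k), with A(0) = -1. *)
Lemma qpochN_column_sum k :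
  q ^+ (k ^ 2 + k) *
    (\sum_(n < h) qpoch (- q) q n * q ^+ (n + 1) * qbinom q n k) =
  - ((-1) ^+ k * qpoch (- q) q k).
Proof.
have step n : qpoch (- q) q n * q ^+ (n + 1) =
    qpoch (- q) q n.+1 - qpoch (- q) q n.
  by rewrite qpoch_recr addn1 exprS; ring.
pose A k := \sum_(n < h) qpoch (- q) q n * q ^+ (n + 1) * qbinom q n k.
rewrite -/(A k); elim: k => [|k IHk].
  rewrite /A; under eq_bigr => n _ do rewrite qbinom0 mulr1 step.
  rewrite -(big_mkord xpredT (fun n => qpoch _ _ n.+1 - qpoch _ _ n)).
  by rewrite telescope_sumr // q_half /qpoch big_nil; ring.
have shift n : q ^+ k.+1 * (q ^+ (n - k) * qbinom q n k) =
    q ^+ (n + 1) * qbinom q n k.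
  have [lt_nk|le_kn] := ltnP n k; first by rewrite qbinom_gt // !mulr0.
  by rewrite mulrA -exprD addSn subnKC // addn1.
have weight n : q ^+ (n + 1) * qbinom q n k =
    q ^+ k.+1 * (qbinom q n k - qbinom q n k.+1 * (1 - q ^+ k.+1)).
  by rewrite qbinom_mul_succ -shift; ring.
have rec : q ^+ k.+1 * q ^+ k.+1 * A k.+1 = - (1 + q ^+ k.+1) * A k.
  (* Summation by parts, using that [n,k+1] vanishes at n = 0. *)
  have parts : A k.+1 = - \sum_(n < h)
      qpoch (- q) q n.+1 * (q ^+ (n - k) * qbinom q n k).
    apply/eqP; rewrite -subr_eq0 opprK /A -big_split /=.
    under eq_bigr => n _.
      rewrite step.
      have -> : (qpoch (- q) q n.+1 - qpoch (- q) q n) * qbinom q n k.+1 +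
          qpoch (- q) q n.+1 * (q ^+ (n - k) * qbinom q n k) =
          qpoch (- q) q n.+1 * qbinom q n.+1 k.+1 -
          qpoch (- q) q n * qbinom q n k.+1.
        by rewrite qbinom_pascal; ring.
      over.
    rewrite -(big_mkord xpredT (fun n => qpoch (- q) q n.+1 * qbinom q n.+1 k.+1
      - qpoch (- q) q n * qbinom q n k.+1)).
    rewrite (telescope_sumr (fun n => qpoch (- q) q n * qbinom q n k.+1)) //.
    by rewrite q_half mul0r qbinom_gt // mulr0 subrr.
  have expand : q ^+ k.+1 * A k.+1 =
      - (A k + q ^+ k.+1 * (A k - (1 - q ^+ k.+1) * A k.+1)).
    rewrite [in LHS]parts mulrN; congr (- _).
    rewrite /A !mulr_sumr -sumrB mulr_sumr -big_split; apply: eq_bigr => n _ /=.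
    rewrite mulrCA shift.
    transitivity (qpoch (- q) q n * q ^+ (n + 1) * qbinom q n k +
        qpoch (- q) q n * q ^+ (n + 1) * (q ^+ (n + 1) * qbinom q n k)).
      by rewrite qpoch_recr addn1 exprS; ring.
    by rewrite weight; ring.
  have -> : q ^+ k.+1 * q ^+ k.+1 * A k.+1 =
      q ^+ k.+1 * A k.+1 - q ^+ k.+1 * (1 - q ^+ k.+1) * A k.+1 by ring.
  by rewrite expand; ring.
have -> : (k.+1 ^ 2 + k.+1 = (k ^ 2 + k) + (k.+1 + k.+1))%N.
  by rewrite !expnS !expn0; lia.
rewrite (exprD q (k ^ 2 + k)) (exprD q k.+1) -mulrA rec.
transitivity (- (1 + q ^+ k.+1) * (q ^+ (k ^ 2 + k) * A k)); first by ring.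
by rewrite IHk qpoch_recr [(-1) ^+ k.+1]exprS exprS; ring.
Qed.

Definition chain_kernel n k : F := q ^+ (k ^ 2 + k) * qbinom q n k.

Lemma chain_kernel_lower n k : (n < k)%N -> chain_kernel n k = 0.
Proof. by move=> lt_nk; rewrite /chain_kernel qbinom_gt ?mulr0. Qed.

(** The relation L o T = - M, from the column sums after exchanging the two
    summations. *)
Lemma sum_lower_apply_chain_kernel (b : nat -> F) :
  \sum_(n < h) qpoch (- q) q n * q ^+ (n + 1) * lower_apply chain_kernel b n =
  - \sum_(n < h) qpoch (- q) q n * (-1) ^+ n * b n.
Proof.
under eq_bigr => n _.
  rewrite (lower_apply_widen chain_kernel_lower _ (ltn_ord n)) mulr_sumr.
  over.
rewrite exchange_big -sumrN; apply: eq_bigr => k _ /=.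
transitivity (q ^+ (k ^ 2 + k) *
  (\sum_(n < h) qpoch (- q) q n * q ^+ (n + 1) * qbinom q n k) * b k).
  rewrite mulr_sumr mulr_suml; apply: eq_bigr => n _.
  by rewrite /chain_kernel; ring.
by rewrite qpochN_column_sum; ring.
Qed.

(** This is where the two bottom factors (q)_{n_1} and
    (-1)^{n_1} q^(-binom(n_1+1,2)) of the two sides meet: binom(k+1,2) is half
    of k^2 + k, so the weight of the kernel inverts the power of q. *)
Lemma lower_apply_chain_kernel_dual n : q != 0 ->
  lower_apply chain_kernel (fun k => (-1) ^+ k * q ^- 'C(k + 1, 2)) n =
  qpoch q q n.
Proof.
move=> q_neq0; rewrite qbinom_theorem; apply: eq_bigr => k _.
rewrite /chain_kernel.
have -> : q ^+ (k ^ 2 + k) = q ^+ 'C(k + 1, 2) * q ^+ 'C(k + 1, 2).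
  rewrite -exprD; congr (_ ^+ _); rewrite addnn bin2 addn1 /= even_halfK.
    by rewrite mulSn -mulnn addnC.
  by rewrite oddM /= andNb.
have -> : (-1) ^+ k * q ^+ 'C(k, 2) * q ^+ k * qbinom q n k =
    (-1) ^+ k * q ^+ 'C(k + 1, 2) * qbinom q n k.
  by rewrite addn1 binS bin1 exprD !mulrA.
have Q_neq0 : q ^+ 'C(k + 1, 2) != 0 by rewrite expf_neq0.
by field.
Qed.

End Intertwining.

Theorem theorem1p2 (R : realType) (m : nat) (hm : (1 <= m)%N)
    (N : nat) (hN : ~~ odd N) (q : R[i]) (hq : N.-primitive_root q) :
  \sum_(n \in chains m)
     (qpoch (- q) q (part n m) * qpoch q q (part n 1)
      * q ^+ (part n m + 1)
      * \prod_(1 <= i < m)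
          (q ^+ (part n i ^ 2 + part n i)
           * qbinom q (part n i.+1) (part n i)))
  = - \sum_(n \in chains m)
     (qpoch (- q) q (part n m) * (-1) ^+ (part n m + part n 1)
      * q ^- 'C(part n 1 + 1, 2)
      * \prod_(1 <= i < m)
          (q ^+ (part n i ^ 2 + part n i)
           * qbinom q (part n i.+1) (part n i))).
Proof.
have N_half n : (N./2 <= n)%N -> qpoch (- q) q n = 0 by exact: qpochN_eq0 hq.
have q_neq0 : q != 0.
  apply/eqP => q0; have /eqP := prim_expr_order hq.
  by rewrite q0 expr0n gtn_eqF ?(prim_order_gt0 hq) // eq_sym oner_eq0.
have half0 := N_half _ (leqnn _).
case: m hm => // m _.
pose g k : R[i] := (-1) ^+ k * q ^- 'C(k + 1, 2).
transitivity (\sum_(n < N./2) qpoch (- q) q n * q ^+ (n + 1) *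
  iter m (lower_apply (chain_kernel q)) (qpoch q q) n).
  rewrite -(@sum_chains _ _ (@chain_kernel_lower _ q) _ _
    (fun n => qpoch (- q) q n * q ^+ (n + 1))) => [|n le_n]; last first.
    by rewrite N_half // mul0r.
  by apply: eq_fsbigr => n _; rewrite [X in X * _]mulrAC.
transitivity (- \sum_(n < N./2) qpoch (- q) q n * (-1) ^+ n *
  iter m (lower_apply (chain_kernel q)) g n); last first.
  rewrite -(@sum_chains _ _ (@chain_kernel_lower _ q) _ _
    (fun n => qpoch (- q) q n * (-1) ^+ n)) => [|n le_n]; last first.
    by rewrite N_half // mul0r.
  congr (- _); apply: eq_fsbigr => n _.
  by rewrite exprD /g !mulrA.
(* The T at the top of the chain is moved to the bottom, next to g. *)
rewrite -(sum_lower_apply_chain_kernel half0) -iterS iterSr.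
have -> // : lower_apply (chain_kernel q) g = qpoch q q.
by apply/boolp.funext => n; exact: lower_apply_chain_kernel_dual.
Qed.
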